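(* Consider the SBP-SAT semi-discretization (described in the context) of the diffusion problem $\frac{\partial\mathcal{U}}{\partial t}-\frac{\partial}{\partial x}\big(\lambda\frac{\partial\mathcal{U}}{\partial x}\big)=\mathcal{F}$ in $\Omega$, $\mathcal{U}=\mathcal{U}_0$ at $t=0$, $\mathcal{U}|_{\Gamma^D}=\mathcal{U}_D$, $n_\gamma\big(\lambda\frac{\partial\mathcal{U}}{\partial x}\big)|_{\Gamma^N}=\mathcal{U}_N$, using a narrow-stencil second-derivative operator of the form $\mathsf{D}_k^{(2)}=\mathsf{H}_k^{-1}[-\mathsf{M}_k+\mathsf{E}_k\Lambda_k\mathsf{D}_{b,k}]$. Assume: (a) $\mathsf{D}_{b,k}$ is invertible or can be modified such that it is invertible (and is then so modified); (b) $\mathsf{D}_k$ and $\mathsf{D}_k^{(2)}$ are nullspace consistent, i.e. their null spaces are $\mathrm{span}\{\bm{1}\}$ and $\mathrm{span}\{\bm{1},\bm{x}_k\}$, respectively; (c) if the norm matrix $\mathsf{H}_k$ is dense (not diagonal), the null spaces of $\mathsf{M}_k$ and $\mathsf{M}_k^T$ are both $\mathrm{span}\{\bm 1\}$. Assume further that the discretization is adjoint consistent and that it produces a symmetric matrix $\mathsf{A}$ (defined in the context), i.e. $\mathsf{T}_{\gamma k}^{(3)}-\mathsf{T}_{\gamma k}^{(2)}=1$. Then the discretization is energy stable if $$\mathsf{T}_{\gamma k}^{(1)}\ge\frac{2}{\alpha_{\gamma k}}\mathsf{T}_{\gamma k}^{(2)}\mathsf{R}_{\gamma k}\Lambda_k\mathsf{V}_k^{+}\Lambda_k\mathsf{R}_{\gamma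 k}^T\mathsf{T}_{\gamma k}^{(2)}+\frac{2}{\alpha_{\gamma v}}\mathsf{T}_{\gamma v}^{(2)}\mathsf{R}_{\gamma v}\Lambda_v\mathsf{V}_v^{+}\Lambda_v\mathsf{R}_{\gamma v}^T\mathsf{T}_{\gamma v}^{(2)}\quad\text{and}\quad\mathsf{T}_{\gamma k}^{(4)}\ge0$$ at every interior interface $\gamma$ shared by elements $\Omega_k$ and $\Omega_v$, and $$\mathsf{T}_{\gamma k}^{(D)}\ge\frac{2}{\alpha_{\gamma k}}\mathsf{R}_{\gamma k}\Lambda_k\mathsf{V}_k^{+}\Lambda_k\mathsf{R}_{\gamma k}^T$$ at every Dirichlet interface $\gamma\subset\Gamma^D$ of an element $\Omega_k$.
   Context: **Mesh.** $\Omega$ is a compact interval tessellated by $n_e$ non-overlapping elements $\Omega_k$, each with $n_p$ nodes $\bm{x}_k$; end points of elements are called interfaces, $\Gamma_k=\partial\Omega_k$, $n_{\gamma k}=1$ if $\gamma$ is the right interface of $\Omega_k$, $-1$ if the left. $\Gamma^I$ is the set of interior interfaces ($\Gamma_k^I$: those of $\Omega_k$); $\Gamma^D$ (nonempty) and $\Gamma^N$ are the Dirichlet and Neumann boundary interfaces. Subscripts $\ell,r$ denote the left and right interface of an element. $\lambda=\lambda(x)>0$ and $\Lambda_k=\mathrm{diag}(\lambda(x_1),\dots,\lambda(x_{n_p}))$. $\bm 1$ is the vector of ones. **Operators.** $\mathsf{D}_k=\mathsf{H}_k^{-1}\mathsf{Q}_k$ is a degree $p$ first-derivative SBP operator: exact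 for polynomials of degree $\le p$, $\mathsf{H}_k$ symmetric positive definite, $\mathsf{Q}_k=\mathsf{S}_k+\frac12\mathsf{E}_k$, $\mathsf{S}_k=-\mathsf{S}_k^T$, $\mathsf{E}_k=\mathsf{E}_k^T$, and $\bm{p}^T\mathsf{E}_k\bm{q}=\sum_{\gamma\in\Gamma_k}[\mathcal P]_\gamma[\mathcal Q]_\gamma n_{\gamma k}$ for polynomials $\mathcal P,\mathcal Q$ of degree $\le\tau$, $\tau\ge p$. Nodes need not be uniform nor include the element boundaries. $\mathsf{E}_k=\mathsf{R}_{rk}^T\mathsf{R}_{rk}-\mathsf{R}_{\ell k}^T\mathsf{R}_{\ell k}$, with $\mathsf{R}_{\gamma k}$ a row vector extrapolating nodal values to $\gamma$ with error $\mathcal{O}(h^{\ge\tau+1})$, where $h=\max_{a,b\in\bm x_k}|a-b|$ is the element size. The narrow-stencil operator is $\mathsf{D}_k^{(2)}=\mathsf{H}_k^{-1}[-\mathsf{M}_k+\mathsf{E}_k\Lambda_k\mathsf{D}_{b,k}]$, a consistent approximation of $\frac{\partial}{\partial x}(\lambda\frac{\partial}{\partial x})$ (for order-matched diagonal-norm operators: exact on $\mathcal P$ whenever $\lambda\mathcal{P}$ is a polynomial of degree $\le p+1$), where $\mathsf{M}_k+\mathsf{M}_k^T$ is symmetric positive semidefinite and $\mathsf{D}_{b,k}$ has, in the rows associated with the element boundaries (those at which $\mathsf{E}_k$ has nonzero rows), consistent approximations of the first derivative (of degree and order $\ge p+1$ for order-matched operators); its remaining rows may be modified to make it invertible, e.g.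 taken to be rows of the identity matrix, so that $\mathsf{D}_{b,k}\bm{1}$ is the vector $\bm v_0$ with entry $0$ in rows where $\mathsf{D}_{b,k}$ consistently approximates the first derivative and entry $1$ elsewhere. For diagonal-norm operators, $\mathsf{D}_k^{(2)}$ has larger dense blocks (more rows and columns) at the top left and bottom right corners than $\mathsf{E}_k$. Set $\mathsf{D}_{\gamma k}=n_{\gamma k}\mathsf{R}_{\gamma k}\Lambda_k\mathsf{D}_{b,k}$, $\mathsf{C}_{\gamma k}=n_{\gamma k}\mathsf{R}_{\gamma k}\Lambda_k$ and $$\mathsf{V}_k=\mathsf{D}_{b,k}^{-T}(\mathsf{M}_k+\mathsf{M}_k^T)\mathsf{D}_{b,k}^{-1}.$$ $\mathsf{V}_k^+$ is the Moore–Penrose pseudoinverse. The $\alpha_{\gamma k}>0$ are interface weights with $\sum_{\gamma\in\Gamma_k}\alpha_{\gamma k}=1$. **Semi-discretization.** With $\Omega_v$ the neighbour of $\Omega_k$ across $\gamma$, $u_D=\mathcal{U}_D$, $u_N=\mathcal{U}_N$, $\bm f_k$ the nodal values of $\mathcal F$, $$\frac{d\bm{u}_{h,k}}{dt}=\mathsf{D}_k^{(2)}\bm{u}_{h,k}+\bm{f}_k-\mathsf{H}_k^{-1}\bm{s}_k^I-\mathsf{H}_k^{-1}\bm{s}_k^B,$$ $$\bm{s}_k^I=\sum_{\gamma\subset\Gamma_k^I}\begin{bmatrix}\mathsf{R}_{\gamma k}^T&\mathsf{D}_{\gamma k}^T\end{bmatrix}\begin{bmatrix}\mathsf{T}^{(1)}_{\gamma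 k}&\mathsf{T}^{(3)}_{\gamma k}\\\mathsf{T}^{(2)}_{\gamma k}&\mathsf{T}^{(4)}_{\gamma k}\end{bmatrix}\begin{bmatrix}\mathsf{R}_{\gamma k}\bm{u}_{h,k}-\mathsf{R}_{\gamma v}\bm{u}_{h,v}\\\mathsf{D}_{\gamma k}\bm{u}_{h,k}+\mathsf{D}_{\gamma v}\bm{u}_{h,v}\end{bmatrix},$$ $$\bm{s}_k^B=\Big\{(\mathsf{T}^{(D)}_{\gamma k}\mathsf{R}_{\gamma k}^T-\mathsf{D}_{\gamma k}^T)(\mathsf{R}_{\gamma k}\bm{u}_{h,k}-u_D)\Big\}_{\gamma\subset\Gamma^D}+\Big\{\mathsf{R}_{\gamma k}^T(\mathsf{D}_{\gamma k}\bm{u}_{h,k}-u_N)\Big\}_{\gamma\subset\Gamma^N},$$ with scalar coefficients $\mathsf{T}^{(1)}_{\gamma k},\dots,\mathsf{T}^{(4)}_{\gamma k},\mathsf{T}^{(D)}_{\gamma k}\in\mathbb{R}$; boundary terms are present only for elements touching the respective boundary. **Adjoint consistency** means that at every interior interface $\gamma$ between $\Omega_k,\Omega_v$: $\mathsf{T}^{(1)}_{\gamma k}=\mathsf{T}^{(1)}_{\gamma v}$, $\mathsf{T}^{(2)}_{\gamma k}+1=-\mathsf{T}^{(2)}_{\gamma v}$, $\mathsf{T}^{(3)}_{\gamma k}-1=-\mathsf{T}^{(3)}_{\gamma v}$, $\mathsf{T}^{(4)}_{\gamma k}=\mathsf{T}^{(4)}_{\gamma v}$, and $\mathsf{M}_k=\mathsf{M}_k^T$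 for every element. **Matrix $\mathsf{A}$.** With $\sigma_k=\mathsf{T}^{(2)}_{\gamma k}+\mathsf{T}^{(3)}_{\gamma k}-1$ and $\sigma_v$ analogously, $$\mathsf{A}=\begin{bmatrix}2\mathsf{T}^{(1)}_{\gamma k}&-2\mathsf{T}^{(1)}_{\gamma k}&\sigma_k\mathsf{C}_{\gamma k}&-\sigma_v\mathsf{C}_{\gamma v}\\-2\mathsf{T}^{(1)}_{\gamma k}&2\mathsf{T}^{(1)}_{\gamma v}&-\sigma_k\mathsf{C}_{\gamma k}&\sigma_v\mathsf{C}_{\gamma v}\\\sigma_k\mathsf{C}_{\gamma k}^T&-\sigma_k\mathsf{C}_{\gamma k}^T&\alpha_{\gamma k}\mathsf{V}_k&\bm 0\\-\sigma_v\mathsf{C}_{\gamma v}^T&\sigma_v\mathsf{C}_{\gamma v}^T&\bm 0&\alpha_{\gamma v}\mathsf{V}_v\end{bmatrix}.$$ **Energy stability** means that for the homogeneous problem ($\mathcal{F}=0$, $\mathcal{U}_D=0$, $\mathcal{U}_N=0$) every solution satisfies $\frac{d}{dt}\|\bm{u}_h\|_{\mathsf{H}}^2\le0$, where $\|\bm{u}_h\|_{\mathsf{H}}^2=\sum_k\bm{u}_{h,k}^T\mathsf{H}_k\bm{u}_{h,k}$.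
   Formalization: For diagonal norms, ''D2 has larger dense blocks than E'' is read as also requiring that D2 v = H^{-1} E y forces D2 v = 0 (implied by (b), M = M^T and null space of M = span{1}); without this the stated claim fails for operators whose M has extra null vectors. *)

(* Defs.v *)
From mathcomp Require Import all_boot all_order all_algebra.
From mathcomp Require Import all_classical all_reals all_analysis.
Set Implicit Arguments.
Unset Strict Implicit.
Unset Printing Implicit Defensive.
Import Order.TTheory GRing.Theory Num.Theory.
Import numFieldNormedType.Exports.
Local Open Scope ring_scope.
Local Open Scope classical_set_scope.

Section LinearAlgebra.
Context {R : realType}.

Definition sc (A : 'M[R]_1) : R := A 0 0.

Definition ones n : 'cV[R]_n := const_mx 1.

Definition posdef n (A : 'M[R]_n) : Prop :=
  forall v : 'cV[R]_n, v != 0 -> 0 < sc (v^T *m A *m v).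

Definition possemidef n (A : 'M[R]_n) : Prop :=
  forall v : 'cV[R]_n, 0 <= sc (v^T *m A *m v).

Definition null_span1 n (A : 'M[R]_n) (w : 'cV[R]_n) : Prop :=
  forall v : 'cV[R]_n, A *m v = 0 <-> exists a, v = a *: w.

Definition null_span2 n (A : 'M[R]_n) (w1 w2 : 'cV[R]_n) : Prop :=
  forall v : 'cV[R]_n, A *m v = 0 <-> exists a b, v = a *: w1 + b *: w2.

Definition penrose n (A X : 'M[R]_n) : Prop :=
  [/\ A *m X *m A = A, X *m A *m X = X,
      (A *m X)^T = A *m X & (X *m A)^T = X *m A].

(* The library's pinvmx is only a partial inverse.  The four Penrose equations
   have exactly one solution, so the default value 0 is never used. *)
Definition mp_pinv n (A : 'M[R]_n) : 'M[R]_n := xget 0 [set X | penrose A X].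

End LinearAlgebra.

Arguments ones {R} n.

(* ne elements, hence ne.+1 interfaces, numbered from left to right: element k
   has left interface k and right interface k+1.  Quantities with subscripts
   (interface, element) are only meaningful, and only ever used, at interfaces
   of that element. *)
Record sbp_sat (R : realType) (ne np : nat) := SbpSat {
  xi : 'I_ne.+1 -> R;                        (* interface positions *)
  node : 'I_ne -> 'cV[R]_np;
  GD : {set 'I_ne.+1};                       (* Dirichlet interfaces *)
  lam : R -> R;                              (* diffusion coefficient *)
  Hm : 'I_ne -> 'M[R]_np;
  Qm : 'I_ne -> 'M[R]_np;
  Sm : 'I_ne -> 'M[R]_np;
  Em : 'I_ne -> 'M[R]_np;
  Mm : 'I_ne -> 'M[R]_np;
  Db : 'I_ne -> 'M[R]_np;
  Rx : 'I_ne.+1 -> 'I_ne -> 'rV[R]_np;       (* extrapolation R_{gamma k} *)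
  T1 : 'I_ne.+1 -> 'I_ne -> R;
  T2 : 'I_ne.+1 -> 'I_ne -> R;
  T3 : 'I_ne.+1 -> 'I_ne -> R;
  T4 : 'I_ne.+1 -> 'I_ne -> R;
  TD : 'I_ne.+1 -> 'I_ne -> R;
  alpha : 'I_ne.+1 -> 'I_ne -> R             (* interface weights *)
}.

Section Discretization.
Context {R : realType} {ne np : nat} (d : sbp_sat R ne np).
Implicit Types (k v : 'I_ne) (g : 'I_ne.+1) (P W L : {poly R}).

Definition lface k : 'I_ne.+1 := widen_ord (leqnSn ne) k.
Definition rface k : 'I_ne.+1 := lift ord0 k.
Definition faces k : {set 'I_ne.+1} := [set lface k; rface k]%SET.

Definition GI : {set 'I_ne.+1} := [set g : 'I_ne.+1 | (0 < g < ne)%N]%SET.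
Definition GB : {set 'I_ne.+1} := (~: GI)%SET.
Definition GN : {set 'I_ne.+1} := (GB :\: GD d)%SET.

Definition neighbours g k v : bool :=
  [&& k != v, g \in faces k & g \in faces v].

Definition nrm g k : R := if g == rface k then 1 else -1.

Definition in_domain (y : R) : Prop := xi d ord0 <= y <= xi d ord_max.

Definition mesh_ok : Prop :=
  [/\ (0 < ne)%N,
      forall g g', (g < g')%N -> xi d g < xi d g',
      forall k (i : 'I_np), xi d (lface k) <= node d k i 0 <= xi d (rface k),
      forall k (i j : 'I_np), (i < j)%N -> node d k i 0 < node d k j 0 &
      [/\ GD d != finset.set0, GD d \subset GB &
          forall y, in_domain y -> 0 < lam d y]].

Definition elt_size k : R :=
  \big[Num.max/0]_(i < np) \big[Num.max/0]_(j < np) `|node d k i 0 - node d k j 0|.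

Definition nodal (f : R -> R) k : 'cV[R]_np := \col_i f (node d k i 0).

Definition Dm k : 'M[R]_np := invmx (Hm d k) *m Qm d k.
Definition Lam k : 'M[R]_np := diag_mx (\row_i lam d (node d k i 0)).
Definition D2 k : 'M[R]_np :=
  invmx (Hm d k) *m (- Mm d k + Em d k *m Lam k *m Db d k).
Definition Dg g k : 'rV[R]_np := nrm g k *: (Rx d g k *m Lam k *m Db d k).
Definition Cg g k : 'rV[R]_np := nrm g k *: (Rx d g k *m Lam k).
Definition V k : 'M[R]_np :=
  (invmx (Db d k))^T *m (Mm d k + (Mm d k)^T) *m invmx (Db d k).
Definition Vp k : 'M[R]_np := mp_pinv (V k).

Definition smooth (U : R -> R) : Prop :=
  forall (m : nat) (y : R), derivable (derive1n m U) y 1.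

(* The row R_{gamma k} extrapolates to the interface with error O(h^q), h being
   the element size: the element is shrunk towards the interface by the factor
   s, which multiplies its size by s. *)
Definition extrapolates (q : nat) g k : Prop :=
  forall U : R -> R, smooth U ->
  exists c : R, forall s : R, 0 < s -> s <= 1 ->
    `|sc (Rx d g k *m \col_i U (xi d g + s * (node d k i 0 - xi d g))) - U (xi d g)|
      <= c * (s * elt_size k) ^+ q.

Definition first_derivative_sbp (p tau : nat) k : Prop :=
  [/\ forall P, (size P <= p.+1)%N ->
        Dm k *m nodal (horner P) k = nodal (horner (P^`())) k,
      (Hm d k)^T = Hm d k /\ posdef (Hm d k),
      [/\ Qm d k = Sm d k + 2^-1 *: Em d k,
          Sm d k = - (Sm d k)^T & Em d k = (Em d k)^T],
      forall P W, (size P <= tau.+1)%N -> (size W <= tau.+1)%N ->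
        sc ((nodal (horner P) k)^T *m Em d k *m nodal (horner W) k)
        = \sum_(g in faces k) P.[xi d g] * W.[xi d g] * nrm g k &
      Em d k = (Rx d (rface k) k)^T *m Rx d (rface k) k
              - (Rx d (lface k) k)^T *m Rx d (lface k) k
      /\ forall g, g \in faces k -> extrapolates tau.+1 g k].

(* Consistency of a difference formula on a given element is exactness on the
   polynomials of low degree: degree 1 for a first derivative and, when lambda is
   a polynomial, degree 2 of lambda P for d/dx (lambda dP/dx). *)
Definition consistent_first (r : 'rV[R]_np) k (i : 'I_np) : Prop :=
  forall P, (size P <= 2)%N ->
    sc (r *m nodal (horner P) k) = P^`().[node d k i 0].

Definition consistent_second k : Prop :=
  forall L P, (forall y, in_domain y -> lam d y = L.[y]) ->
    (size (L * P)%R <= 3)%N ->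
    D2 k *m nodal (horner P) k = nodal (horner ((L * P^`())^`())) k.

Definition boundary_row k (i : 'I_np) : bool := row i (Em d k) != 0.

(* Db is the matrix after the possible modification of its rows other than the
   boundary rows.  That modification does not affect E Lam Db. *)
Definition second_derivative_sbp k : Prop :=
  [/\ consistent_second k,
      possemidef (Mm d k + (Mm d k)^T) &
      forall i, boundary_row k i -> consistent_first (row i (Db d k)) k i].

Definition Db_invertible k : Prop := Db d k \in unitmx.

Definition nullspace_consistent k : Prop :=
  null_span1 (Dm k) (ones np) /\ null_span2 (D2 k) (ones np) (node d k).

Definition dense_norm_nullspace k : Prop :=
  ~~ is_diag_mx (Hm d k) ->
  null_span1 (Mm d k) (ones np) /\ null_span1 (Mm d k)^T (ones np).

(* E is confined to b x b corner blocks, while the corner blocks of D2 have more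
   rows and more columns (no zero row or column within the r x c block).  Zero
   patterns alone do not prevent M from annihilating a nonconstant vector v,
   that is D2 v = H^-1 E Lam Db v: the larger blocks of D2 must also act
   differently from those of E.  The last clause expresses this: a nonzero D2 v
   is never of the form H^-1 E y. *)
Definition larger_dense_blocks k : Prop :=
  exists b r c : nat,
  [/\ [/\ (b < r)%N, (b < c)%N, (r <= np)%N & (c <= np)%N],
      forall i j : 'I_np, Em d k i j != 0 ->
        (i < b)%N && (j < b)%N || (np <= i + b)%N && (np <= j + b)%N,
      (forall i : 'I_np, (i < r)%N ->
         exists2 j : 'I_np, (j < c)%N & D2 k i j != 0) /\
      (forall j : 'I_np, (j < c)%N ->
         exists2 i : 'I_np, (i < r)%N & D2 k i j != 0),
      (forall i : 'I_np, (np <= i + r)%N ->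
         exists2 j : 'I_np, (np <= j + c)%N & D2 k i j != 0) /\
      (forall j : 'I_np, (np <= j + c)%N ->
         exists2 i : 'I_np, (np <= i + r)%N & D2 k i j != 0) &
      forall v y : 'cV[R]_np,
        D2 k *m v = invmx (Hm d k) *m Em d k *m y -> D2 k *m v = 0].

Definition diagonal_norm_blocks k : Prop :=
  is_diag_mx (Hm d k) -> larger_dense_blocks k.

Definition weights_ok : Prop :=
  (forall k g, g \in faces k -> 0 < alpha d g k) /\
  (forall k, \sum_(g in faces k) alpha d g k = 1).

Definition sI (u : 'I_ne -> 'cV[R]_np) k : 'cV[R]_np :=
  \sum_(g in (faces k :&: GI)%SET) \sum_(v | neighbours g k v)
    (row_mx (Rx d g k)^T (Dg g k)^T
     *m block_mx (T1 d g k)%:M (T3 d g k)%:M (T2 d g k)%:M (T4 d g k)%:M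
     *m col_mx (Rx d g k *m u k - Rx d g v *m u v)
               (Dg g k *m u k + Dg g v *m u v)).

Definition sB (uD uN : R -> R) (u : 'I_ne -> 'cV[R]_np) k : 'cV[R]_np :=
  \sum_(g in (faces k :&: GD d)%SET)
    (TD d g k *: (Rx d g k)^T - (Dg g k)^T) *m (Rx d g k *m u k - (uD (xi d g))%:M)
  + \sum_(g in (faces k :&: GN)%SET)
    (Rx d g k)^T *m (Dg g k *m u k - (uN (xi d g))%:M).

Definition rhs (F UD UN : R -> R -> R) (t : R) (u : 'I_ne -> 'cV[R]_np) k :
    'cV[R]_np :=
  D2 k *m u k + nodal (F t) k
  - invmx (Hm d k) *m sI u k - invmx (Hm d k) *m sB (UD t) (UN t) u k.

Definition solves (F UD UN : R -> R -> R) (T : R)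
    (u : R -> 'I_ne -> 'cV[R]_np) : Prop :=
  forall t, 0 < t -> t < T -> forall k (i : 'I_np),
    is_derive t (1 : R) (fun s => u s k i 0) (rhs F UD UN t (u t) k i 0).

Definition energy (u : 'I_ne -> 'cV[R]_np) : R :=
  \sum_k sc ((u k)^T *m Hm d k *m u k).

Definition zero_data (t y : R) : R := 0.

Definition energy_stable : Prop :=
  forall (T : R) (u : R -> 'I_ne -> 'cV[R]_np),
    solves zero_data zero_data zero_data T u ->
    forall t, 0 < t -> t < T ->
      derivable (fun s => energy (u s)) t 1 /\
      derive1 (fun s => energy (u s)) t <= 0.

Definition adjoint_consistent : Prop :=
  (forall g k v, neighbours g k v ->
     [/\ T1 d g k = T1 d g v, T2 d g k + 1 = - T2 d g v,
         T3 d g k - 1 = - T3 d g v & T4 d g k = T4 d g v]) /\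
  (forall k, Mm d k = (Mm d k)^T).

Definition sigma g k : R := T2 d g k + T3 d g k - 1.

Definition Amx g k v : 'M[R]_((1 + 1) + (np + np)) :=
  block_mx
    (block_mx (2 * T1 d g k)%:M (- (2 * T1 d g k))%:M
              (- (2 * T1 d g k))%:M (2 * T1 d g v)%:M)
    (block_mx (sigma g k *: Cg g k) (- (sigma g v *: Cg g v))
              (- (sigma g k *: Cg g k)) (sigma g v *: Cg g v))
    (block_mx (sigma g k *: (Cg g k)^T) (- (sigma g k *: (Cg g k)^T))
              (- (sigma g v *: (Cg g v)^T)) (sigma g v *: (Cg g v)^T))
    (block_mx (alpha d g k *: V k) 0 0 (alpha d g v *: V v)).

(* With the blocks as displayed, the first equation always holds (M + M^T being
   symmetric); the condition on the coefficients is the second one. *)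
Definition A_symmetric : Prop :=
  forall g k v, neighbours g k v ->
    (Amx g k v)^T = Amx g k v /\ T3 d g k - T2 d g k = 1.

Definition RVR g k : R :=
  sc (Rx d g k *m Lam k *m Vp k *m Lam k *m (Rx d g k)^T).

End Discretization.

(* Main.v *)
Require Import Defs.
From mathcomp Require Import all_boot all_order all_algebra.
From mathcomp Require Import all_classical all_reals all_analysis.
From mathcomp Require Import ring lra zify.
Set Implicit Arguments.
Unset Strict Implicit.
Unset Printing Implicit Defensive.
Import Order.TTheory GRing.Theory Num.Theory.
Local Open Scope ring_scope.

(** The proof is the energy method. Half of the energy rate is the sum over the
    elements of [u^T H u'], and multiplying the right-hand side by [u^T H] leaves
    the dissipation [- u^T M u], the boundary products [(R u) (D u)] coming from
    [E Lam Db], and the penalty terms (lemma [sc_rhs]). As the weights [alpha] of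
    an element add up to one, its dissipation can be distributed over its two
    faces, so that the rate becomes a sum of independent contributions: one for
    each interior interface, involving its two elements, and one for each boundary
    interface.

    At an interior interface, let [a] be the jump of the traces and [b] the sum of
    the outward fluxes [D_k u_k] and [D_v u_v]. The conditions on the
    coefficients reduce the contribution to
      [- T1 a^2 - T4 b^2 - 2 a (T2_k D_k u_k - T2_v D_v u_v)]
    minus the two dissipation shares ([interface_balance]). At a Dirichlet
    interface it is [2 (R u) (D u) - TD (R u)^2] minus one share, and at a Neumann
    interface it is minus one share. In all cases a product of a number with a
    flux has to be absorbed by a share of the dissipation, which in terms of
    [w = Db u] is half the quadratic form of [V]. This is Young's inequality for the
    seminorm of [V] ([young_pinv], [flux_bound]), and its cost [R Lam V^+ Lam R^T]
    is what the bounds on [T1] and [TD] pay for.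

    Young's inequality requires that [R Lam] vanish on the kernel of [V], that is,
    that [M z = 0] imply [R Lam Db z = 0] ([flux_kernel]). For a dense norm, [z] is
    constant and the rows of [Db] seen by [R] differentiate it to zero. For a
    diagonal norm, [M z = 0] means that [D2 z] equals [H^-1 E Lam Db z], which the
    larger blocks of [D2] allow only if it vanishes; then [E Lam Db z = 0], and
    since the rows [R] of the two faces are linearly independent, both fluxes are
    zero. The independence comes from the exactness of the extrapolation on
    polynomials of degree at most one, which follows from its order of accuracy
    ([extrapolates_moment]). *)

(** * Scalar products and the pseudoinverse *)

Section LinearAlgebra.
Context {R : realType}.
Implicit Types n r : nat.

Lemma scD (A B : 'M[R]_1) : sc (A + B) = sc A + sc B.
Proof. by rewrite /sc mxE. Qed.

Lemma scN (A : 'M[R]_1) : sc (- A) = - sc A.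
Proof. by rewrite /sc mxE. Qed.

Lemma scZ a (A : 'M[R]_1) : sc (a *: A) = a * sc A.
Proof. by rewrite /sc mxE. Qed.

Lemma sc_scalar a : sc (a%:M : 'M[R]_1) = a.
Proof. by rewrite /sc mxE. Qed.

Lemma scT (A : 'M[R]_1) : sc A^T = sc A.
Proof. by rewrite /sc mxE. Qed.

Lemma scM (A B : 'M[R]_1) : sc (A *m B) = sc A * sc B.
Proof. by rewrite /sc mxE big_ord1. Qed.

Lemma sc_sum (I : Type) (s : seq I) (P : pred I) (F : I -> 'M[R]_1) :
  sc (\sum_(i <- s | P i) F i) = \sum_(i <- s | P i) sc (F i).
Proof. by rewrite /sc summxE. Qed.

Lemma mx1E (A : 'M[R]_1) : A = (sc A)%:M.
Proof. exact: mx11_scalar. Qed.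

Lemma sc_gram_eq0 n (v : 'cV[R]_n) : sc (v^T *m v) = 0 -> v = 0.
Proof.
rewrite /sc mxE => /eqP; rewrite psumr_eq0 => [/allP h|i _]; last first.
  by rewrite mxE -expr2 sqr_ge0.
apply/colP => i; have := h i (mem_index_enum _).
by rewrite !mxE mulf_eq0 orbb => /eqP.
Qed.

Lemma posdef_unitmx n (A : 'M[R]_n) : posdef A -> A \in unitmx.
Proof.
move=> hA; rewrite -row_free_unit; apply: inj_row_free => v vA.
apply/eqP; apply/negPn/negP => v0.
have := hA v^T; rewrite trmx_eq0 => /(_ v0).
by rewrite trmxK vA mul0mx /sc mxE ltxx.
Qed.

Lemma row_free_gram_unit r n (C : 'M[R]_(r, n)) :
  row_free C -> C *m C^T \in unitmx.
Proof.
move=> hC; rewrite -row_free_unit; apply: inj_row_free => v vCC.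
apply: (row_free_inj hC); rewrite mul0mx.
apply: trmx_inj; rewrite trmx0; apply: sc_gram_eq0.
by rewrite trmxK trmx_mul mulmxA -(mulmxA v) vCC mul0mx /sc mxE.
Qed.

(** A full rank factorization [A = B *m C] gives the pseudoinverse explicitly
    as [C^T (C C^T)^-1 (B^T B)^-1 B^T]; the Gram matrices are invertible because
    the scalars are real. *)
Lemma mp_pinvP n (A : 'M[R]_n) : penrose A (mp_pinv A).
Proof.
rewrite /mp_pinv; apply: (xgetPex 0 (P := [set X | penrose A X]%classic)).
have [r [B [C [AE uB uC]]]] : exists (r : nat) (B : 'M[R]_(n, r)) (C : 'M[R]_(r, n)),
    [/\ A = B *m C, B^T *m B \in unitmx & C *m C^T \in unitmx].
  exists (\rank A), (col_base A), (row_base A); split; first by rewrite mulmx_base.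
    rewrite -[X in _ *m X]trmxK; apply: row_free_gram_unit.
    by rewrite /row_free mxrank_tr; have := col_base_full A.
  by apply: row_free_gram_unit; apply: row_base_free.
set G := C *m C^T in uC; set F := B^T *m B in uB.
have GT : (invmx G)^T = invmx G by rewrite trmx_inv /G trmx_mul trmxK.
have FT : (invmx F)^T = invmx F by rewrite trmx_inv /F trmx_mul trmxK.
set X := C^T *m invmx G *m invmx F *m B^T.
have AX : A *m X = B *m invmx F *m B^T.
  by rewrite AE /X !mulmxA -(mulmxA B) -/G -(mulmxA B) mulmxV// mulmx1.
have XA : X *m A = C^T *m invmx G *m C.
  by rewrite AE /X !mulmxA -(mulmxA _ B^T) -/F -(mulmxA _ (invmx F)) mulVmx//
             mulmx1.
exists X; split.
- by rewrite AX AE !mulmxA -(mulmxA _ B^T) -/F -(mulmxA B) mulVmx// mulmx1.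
- by rewrite XA /X !mulmxA -(mulmxA _ C) -/G -(mulmxA C^T) mulVmx// mulmx1.
- by rewrite AX !trmx_mul FT trmxK mulmxA.
- by rewrite XA !trmx_mul GT trmxK mulmxA.
Qed.

(** Completing the square in the seminorm of [V]: once [c] vanishes on the kernel
    of [V], it is the [V]-product with [V^+ c^T], and the inequality is the
    nonnegativity of the square of [a w - 2 t V^+ c^T], divided by [2 a]. *)
Lemma young_pinv n (V : 'M[R]_n) (c : 'rV[R]_n) (w : 'cV[R]_n) (a t : R) :
  V^T = V -> possemidef V -> (forall z : 'cV[R]_n, V *m z = 0 -> c *m z = 0) ->
  0 < a ->
  2 * t * sc (c *m w)
    <= a / 2 * sc (w^T *m V *m w) + 2 / a * t ^+ 2 * sc (c *m mp_pinv V *m c^T).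
Proof.
move=> VT Vpos Vker a0; set X := mp_pinv V.
have [p1 p2 p3 p4] := mp_pinvP V; rewrite -/X in p1 p2 p3 p4.
have cXV : c *m X *m V = c.
  apply/eqP; rewrite eq_sym -subr_eq0 -[X in X - _]mulmx1 -mulmxA -mulmxBr.
  apply/eqP/rowP => j.
  have : c *m (col j (1%:M - X *m V)) = 0.
    by apply: Vker; rewrite colE mulmxA mulmxBr mulmx1 mulmxA p1 subrr mul0mx.
  by rewrite !colE mulmxA -colE => /matrixP/(_ 0 0); rewrite !mxE.
set y := X^T *m c^T.
have yV : y^T *m V = c by rewrite /y trmx_mul !trmxK.
have Vy : V *m y = c^T by rewrite -[in RHS]yV trmx_mul trmxK VT.
have cy : sc (c *m y) = sc (c *m X *m c^T).
  by rewrite -[LHS]scT /y !trmx_mul !trmxK.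
have wVy : sc (w^T *m V *m y) = sc (c *m w).
  by rewrite -mulmxA Vy -[LHS]scT trmx_mul !trmxK.
have := Vpos (a *: w - (2 * t) *: y).
set S := sc (w^T *m V *m w); set K := sc (c *m w).
have -> : sc ((a *: w - (2 * t) *: y)^T *m V *m (a *: w - (2 * t) *: y))
    = a ^+ 2 * S - 4 * a * t * K + 4 * t ^+ 2 * sc (c *m X *m c^T).
  rewrite [(_ - _)^T]linearB /= ![(_ *: _)^T]linearZ /=.
  rewrite mulmxBl -!scalemxAl mulmxBr !mulmxBl.
  rewrite -!scalemxAl -!scalemxAr yV !(scD, scN, scZ) wVy cy -/S -/K; ring.
move=> h.
rewrite -subr_ge0.
have -> : a / 2 * S + 2 / a * t ^+ 2 * sc (c *m X *m c^T) - 2 * t * K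
   = (2 * a)^-1 * (a ^+ 2 * S - 4 * a * t * K + 4 * t ^+ 2 * sc (c *m X *m c^T)).
  by field; rewrite gt_eqF.
by rewrite mulr_ge0// invr_ge0 mulr_ge0// ltW.
Qed.

End LinearAlgebra.

(** * Exactness of the extrapolation rows *)

Section Extrapolation.
Context {R : realType}.

Lemma smooth_horner (P : {poly R}) : smooth (horner P).
Proof.
move=> m y; suff -> : derive1n m (horner P) = horner (P^`(m)).
  exact: derivable_horner.
by elim: m => [|m IH]; rewrite ?derivn0// derive1nS IH derivnS derivE.
Qed.

Lemma exponent_le0 (x C : R) (m q : nat) : (m < q)%N ->
  (forall s, 0 < s -> s <= 1 -> s ^+ m * x <= C * s ^+ q) -> x <= 0.
Proof.
move=> mq h; rewrite leNgt; apply/negP => x0.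
have xC : x <= C by have := h 1 ltr01 (lexx _); rewrite !expr1n mul1r mulr1.
have C0 : 0 < C by apply: lt_le_trans xC.
(* With this [s], the hypothesis bounds [x] by [C s = x / 2]. *)
set s := x / (2 * C).
have s0 : 0 < s by rewrite divr_gt0// mulr_gt0.
have s1 : s <= 1 by rewrite ler_pdivrMr ?mulr_gt0// mul1r; lra.
have := h s s0 s1.
have -> : s ^+ q = s ^+ m * (s * s ^+ (q - m.+1)).
  by rewrite -exprS -exprD subnSK// subnKC// ltnW.
rewrite mulrCA ler_pM2l ?exprn_gt0// mulrCA.
have : C * s ^+ (q - m.+1) <= C by rewrite ger_pMr// exprn_ile1 // ltW.
move=> h1 h2.
have : s * (C * s ^+ (q - m.+1)) <= s * C by rewrite ler_pM2l.
have -> : s * C = x / 2 by rewrite /s; field; rewrite gt_eqF.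
by move: h2; lra.
Qed.

Context {ne np : nat} (d : sbp_sat R ne np).

(** Applied to [(y - xi)^m], the error bound compares [s^m] times the defect with
    [s^q]; letting [s] tend to [0] shows that the defect vanishes. *)
Lemma extrapolates_moment q g k m : extrapolates d q g k -> (m < q)%N ->
  sc (Rx d g k *m \col_i (node d k i 0 - xi d g) ^+ m) = (m == 0%N)%:R.
Proof.
move=> hex mq; have [c hc] := hex _ (@smooth_horner (('X - (xi d g)%:P) ^+ m)).
apply/eqP; rewrite -subr_eq0 -normr_eq0 -normr_le0.
apply: (@exponent_le0 _ (c * elt_size d k ^+ q) _ _ mq) => s s0 s1.
have := hc s s0 s1.
have -> : \col_i (('X - (xi d g)%:P) ^+ m).[xi d g + s * (node d k i 0 - xi d g)]
        = s ^+ m *: \col_i (node d k i 0 - xi d g) ^+ m.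
  apply/colP => i; rewrite !mxE horner_exp hornerXsubC -exprMn; congr (_ ^+ _).
  by ring.
rewrite horner_exp hornerXsubC subrr expr0n -scalemxAr scZ exprMn.
have e0 : (m == 0%N)%:R = s ^+ m * (m == 0%N)%:R :> R.
  by case: (m) => [|?]; rewrite ?expr0 ?mul1r//= mulr0.
rewrite [X in _ - X]e0 -mulrBr normrM normr_id (ger0_norm (exprn_ge0 _ (ltW s0))).
by rewrite [s ^+ q * _]mulrC mulrA.
Qed.

End Extrapolation.

(** * Faces and neighbours *)

Section Mesh.
Context {ne : nat}.
Implicit Types (k v : 'I_ne) (g : 'I_ne.+1).

Lemma in_faces g k : (g \in faces k) = (g == k :> nat) || (g == k.+1 :> nat).
Proof. by rewrite !inE -!val_eqE. Qed.

Lemma lface_neq_rface k : lface k != rface k.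
Proof. by rewrite -val_eqE neq_ltn ltnSn. Qed.

Lemma sum_faces (V : nmodType) k (F : 'I_ne.+1 -> V) :
  \sum_(g in faces k) F g = F (lface k) + F (rface k).
Proof. by rewrite big_setU1 ?big_set1//= inE lface_neq_rface. Qed.

Lemma neighbours_sym g k v : neighbours g k v = neighbours g v k.
Proof. by rewrite /neighbours eq_sym [X in _ && X]andbC. Qed.

Lemma neighbour_unique g k : g \in faces k -> g \in GI (ne := ne) ->
  exists v : 'I_ne, neighbours g k =1 pred1 v.
Proof.
rewrite in_faces inE => /orP[] /eqP gk /andP[g0 gn].
  have vn : (k.-1 < ne)%N by rewrite (leq_ltn_trans (leq_pred k)).
  exists (Ordinal vn) => v; rewrite /neighbours !in_faces /= -!val_eqE /=.
  by apply/idP/idP; lia.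
have vn : (k.+1 < ne)%N by rewrite -gk.
exists (Ordinal vn) => v; rewrite /neighbours !in_faces /= -!val_eqE /=.
by apply/idP/idP; lia.
Qed.

End Mesh.

(** * The kernel of the dissipation matrix *)

Section Kernel.
Context {R : realType} {ne np : nat} (d : sbp_sat R ne np) (k : 'I_ne).

Let r := Rx d (rface k) k.
Let l := Rx d (lface k) k.

Lemma extrapolates_one q g : (0 < q)%N -> extrapolates d q g k ->
  sc (Rx d g k *m ones np) = 1.
Proof.
move=> q0 hex; rewrite -[RHS](extrapolates_moment hex q0); congr (sc (_ *m _)).
by apply/colP => i; rewrite !mxE expr0.
Qed.

Lemma extrapolates_node q g : (1 < q)%N -> extrapolates d q g k ->
  sc (Rx d g k *m node d k) = xi d g.
Proof.
move=> q1 hex; have h1 := extrapolates_one (ltnW q1) hex.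
have -> : node d k = \col_i (node d k i 0 - xi d g) ^+ 1 + xi d g *: ones np.
  by apply/colP => i; rewrite !mxE expr1; ring.
by rewrite mulmxDr -scalemxAr scD scZ h1 (extrapolates_moment hex q1) add0r mulr1.
Qed.

Context (q : nat) (q1 : (1 < q)%N) (hxi : xi d (lface k) < xi d (rface k)).
Context (hex : forall g, g \in faces k -> extrapolates d q g k).
Context (hE : Em d k = r^T *m r - l^T *m l).

(** Evaluating the relation on the constants and on the nodes gives [a + b = 0] and
    [a x_r + b x_l = 0], a Vandermonde system with distinct points. *)
Lemma face_rows_independent (a b : R) : a *: r + b *: l = 0 -> a = 0 /\ b = 0.
Proof.
have hr : extrapolates d q (rface k) k by apply: hex; rewrite in_faces eqxx orbT.
have hl : extrapolates d q (lface k) k by apply: hex; rewrite in_faces eqxx.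
move=> ab0.
have e1 : sc ((a *: r + b *: l) *m ones np) = 0 by rewrite ab0 mul0mx /sc mxE.
have e2 : sc ((a *: r + b *: l) *m node d k) = 0 by rewrite ab0 mul0mx /sc mxE.
move: e1 e2; rewrite !mulmxDl -!scalemxAl !scD !scZ.
rewrite (extrapolates_one (ltnW q1) hr) (extrapolates_one (ltnW q1) hl).
rewrite (extrapolates_node q1 hr) (extrapolates_node q1 hl) => e1 e2.
have bE : b = - a by lra.
have /eqP : a * (xi d (rface k) - xi d (lface k)) = 0 by rewrite -e2 bE; ring.
rewrite mulf_eq0 subr_eq0 [_ == xi d (lface k)]gt_eqF// orbF => /eqP a0.
by rewrite bE a0 oppr0.
Qed.

(** [E y = (r y) r^T - (l y) l^T] is a combination of independent rows. *)
Lemma Em_mul0 (y : 'cV[R]_np) g : Em d k *m y = 0 -> g \in faces k ->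
  Rx d g k *m y = 0.
Proof.
rewrite hE mulmxBl -!mulmxA (mx1E (r *m y)) (mx1E (l *m y)) !mul_mx_scalar => e.
have /face_rows_independent[r0 /eqP l0] :
    sc (r *m y) *: r + (- sc (l *m y)) *: l = 0.
  by apply: trmx_inj; rewrite trmx0 -e linearD /= !linearZ /= scaleNr scalerN.
rewrite oppr_eq0 in l0.
by rewrite !inE => /orP[] /eqP ->; rewrite -/r -/l [LHS]mx1E ?r0 ?(eqP l0) raddf0.
Qed.

(** Row [i] of [E] is [r_i r - l_i l], so it can only vanish if both [r_i] and
    [l_i] do. *)
Lemma boundary_row_supp g i : g \in faces k -> Rx d g k 0 i != 0 ->
  boundary_row d k i.
Proof.
move=> gk gi; apply/negP => /eqP Ei.
have /face_rows_independent[r0 /eqP l0] : r 0 i *: r + (- l 0 i) *: l = 0.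
  rewrite -Ei hE; apply/rowP => j; rewrite !mxE !big_ord1 !mxE; ring.
rewrite oppr_eq0 in l0.
by move: gk gi; rewrite !inE => /orP[] /eqP ->; rewrite -/r -/l ?r0 ?(eqP l0) eqxx.
Qed.

Context (hD2 : second_derivative_sbp d k) (hH : Hm d k \in unitmx).
Context (hblocks : diagonal_norm_blocks d k) (hc : dense_norm_nullspace d k).

(** The rows of [Db] that may have been modified, and hence may not annihilate
    constants, are not boundary rows, so [R] does not see them. *)
Lemma flux_ones g : g \in faces k -> Rx d g k *m Lam d k *m Db d k *m ones np = 0.
Proof.
move=> gk; have [_ _ hcons] := hD2.
rewrite -!mulmxA; apply/matrixP => a b; rewrite !ord1 mxE [RHS]mxE big1// => i _.
have [->|gi] := eqVneq (Rx d g k 0 i) 0; first by rewrite mul0r.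
have := hcons i (boundary_row_supp gk gi) 1.
rewrite size_poly1 => /(_ isT); rewrite derivC horner0 => hi.
rewrite mul_diag_mx !mxE.
suff -> : \sum_j Db d k i j * ones np j 0 = 0 by rewrite !mulr0.
rewrite -[RHS]hi /sc !mxE; apply: eq_bigr => j _.
by rewrite !mxE hornerC.
Qed.

(** For a diagonal norm the hypothesis on the blocks of [D2] turns [M z = 0] into
    [E Lam Db z = 0]; for a dense norm [z] is constant. *)
Lemma flux_kernel g (z : 'cV[R]_np) : g \in faces k -> Mm d k *m z = 0 ->
  Rx d g k *m Lam d k *m Db d k *m z = 0.
Proof.
move=> gk Mz; have [hdiag|hdense] := boolP (is_diag_mx (Hm d k)); last first.
  have [/(_ z) [/(_ Mz) [a ->] _] _] := hc hdense.
  by rewrite -scalemxAr flux_ones// scaler0.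
have [b [s [t [_ _ _ _ hD2v]]]] := hblocks hdiag.
have D2z : D2 d k *m z = invmx (Hm d k) *m Em d k *m (Lam d k *m Db d k *m z).
  by rewrite /D2 -!mulmxA mulmxDl mulNmx Mz oppr0 add0r !mulmxA.
have := hD2v _ _ D2z; rewrite D2z -mulmxA => /(congr1 (mulmx (Hm d k))).
rewrite mulmx0 mulKVmx// => /Em_mul0/(_ gk).
by rewrite !mulmxA.
Qed.

Context (hM : Mm d k = (Mm d k)^T) (hDb : Db d k \in unitmx).

Lemma V_sym : (V d k)^T = V d k.
Proof. by rewrite /V !trmx_mul trmxK linearD /= trmxK -hM mulmxA. Qed.

Lemma V_possemidef : possemidef (V d k).
Proof.
have [_ hpos _] := hD2 => w.
by have := hpos (invmx (Db d k) *m w); rewrite /V trmx_mul !mulmxA.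
Qed.

Lemma V_kernel g (w : 'cV[R]_np) : g \in faces k -> V d k *m w = 0 ->
  Rx d g k *m Lam d k *m w = 0.
Proof.
move=> gk /(congr1 (mulmx (Db d k)^T)).
rewrite /V !mulmxA -trmx_mul mulVmx// trmx1 mul1mx mulmx0 -hM -mulmxA mulmxDl.
rewrite -mulr2n -scaler_nat => /eqP; rewrite scaler_eq0 pnatr_eq0/= => /eqP.
by move/(flux_kernel gk); rewrite mulmxA -(mulmxA _ (Db d k)) mulmxV// mulmx1.
Qed.

(** Young's inequality for [w = Db u], where the quadratic form of [V] is twice
    the dissipation [u^T M u]; the sign in [Dg] squares to one. With the weight of
    the face as [a], the first term is its share of the dissipation, and the last
    one is left for the penalty to cover. *)
Lemma flux_bound g (u : 'cV[R]_np) (a t : R) : g \in faces k -> 0 < a ->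
  2 * t * sc (Dg d g k *m u)
    <= a * sc (u^T *m Mm d k *m u) + 2 / a * t ^+ 2 * RVR d g k.
Proof.
move=> gk a0.
have n2 : (nrm g k : R) ^+ 2 = 1 by rewrite /nrm; case: ifP; rewrite ?sqrrN expr1n.
have := young_pinv (Db d k *m u) (t * nrm g k) V_sym V_possemidef
  (fun w => @V_kernel g w gk) a0.
have -> : sc ((Db d k *m u)^T *m V d k *m (Db d k *m u))
        = 2 * sc (u^T *m Mm d k *m u).
  have VDb : V d k *m (Db d k *m u) = (invmx (Db d k))^T *m (2 *: (Mm d k *m u)).
    by rewrite /V -!mulmxA (mulKmx hDb) -hM mulmxDl -mulr2n -scaler_nat.
  rewrite -mulmxA VDb trmx_mul -(mulmxA u^T (Db d k)^T).
  rewrite (mulmxA (Db d k)^T) -trmx_mul.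
  by rewrite mulVmx// trmx1 mul1mx -scalemxAr scZ mulmxA.
rewrite exprMn n2 mulr1 trmx_mul tr_diag_mx !mulmxA -/(Lam d k) -/(Vp d k).
rewrite -/(RVR d g k) /Dg -!scalemxAl scZ [a / 2 * _]mulrA divfK ?pnatr_eq0//.
by rewrite !mulrA.
Qed.

End Kernel.

(** * The energy rate *)

Section EnergyRate.
Context {R : realType} {ne np : nat} (d : sbp_sat R ne np).
Implicit Types (k v : 'I_ne) (g : 'I_ne.+1).

Lemma is_derive_energy (u : R -> 'I_ne -> 'cV[R]_np) (u' : 'I_ne -> 'cV[R]_np)
    (t : R) :
  (forall k, (Hm d k)^T = Hm d k) ->
  (forall k i, is_derive t (1 : R) (fun s => u s k i 0) (u' k i 0)) ->
  is_derive t (1 : R) (fun s => energy d (u s))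
    (2 * \sum_k sc ((u t k)^T *m Hm d k *m u' k)).
Proof.
move=> Hsym hu.
have -> : (fun s => energy d (u s)) = \sum_(k < ne) \sum_(i < np) \sum_(j < np)
    Hm d k i j *: ((fun s => u s k i 0) * (fun s => u s k j 0)).
  apply/funext => s; rewrite /energy fct_sumE; apply: eq_bigr => k _.
  rewrite fct_sumE -mulmxA /sc mxE; apply: eq_bigr => i _.
  rewrite fct_sumE !mxE mulr_sumr; apply: eq_bigr => j _.
  by rewrite mulrCA.
have hd : is_derive t (1 : R) (\sum_(k < ne) \sum_(i < np) \sum_(j < np)
    Hm d k i j *: ((fun s => u s k i 0) * (fun s => u s k j 0)))
  (\sum_(k < ne) \sum_(i < np) \sum_(j < np)
    Hm d k i j *: (u t k i 0 *: u' k j 0 + u t k j 0 *: u' k i 0)).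
  apply: is_derive_sum => k; apply: is_derive_sum => i.
  apply: is_derive_sum => j; apply: is_deriveZ; exact: is_deriveM.
apply: (is_derive_eq hd); rewrite mulr_sumr; apply: eq_bigr => k _.
set S := \sum_i \sum_j Hm d k i j * (u t k i 0 * u' k j 0).
have SE : sc ((u t k)^T *m Hm d k *m u' k) = S.
  rewrite -mulmxA /sc mxE; apply: eq_bigr => i _.
  by rewrite !mxE mulr_sumr; apply: eq_bigr => j _; rewrite mulrCA.
have SE' : S = \sum_i \sum_j Hm d k i j * (u t k j 0 * u' k i 0).
  rewrite /S exchange_big; apply: eq_bigr => i _; apply: eq_bigr => j _.
  by rewrite -[in LHS]Hsym mxE.
rewrite SE mulr_natl mulr2n {2}SE' /S -big_split /=.
apply: eq_bigr => i _; rewrite -big_split /=; apply: eq_bigr => j _.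
by rewrite /GRing.scale /= mulrDr.
Qed.

Context (u : 'I_ne -> 'cV[R]_np).

Let trace g k : R := sc (Rx d g k *m u k).
Let flux g k : R := sc (Dg d g k *m u k).
Let diss k : R := sc ((u k)^T *m Mm d k *m u k).

Lemma row_trace g k : (u k)^T *m (Rx d g k)^T = (trace g k)%:M.
Proof. by rewrite -trmx_mul [LHS]mx1E scT. Qed.

Lemma row_flux g k : (u k)^T *m (Dg d g k)^T = (flux g k)%:M.
Proof. by rewrite -trmx_mul [LHS]mx1E scT. Qed.

(** What the interior penalty at the face [g] of [k] contributes to [u_k^T sI];
    [v] is the neighbour. *)
Definition interface_work g k v : R :=
  trace g k * (T1 d g k * (trace g k - trace g v)
               + T3 d g k * (flux g k + flux g v))
  + flux g k * (T2 d g k * (trace g k - trace g v)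
                + T4 d g k * (flux g k + flux g v)).

Lemma sc_sI k : sc ((u k)^T *m sI d u k) =
  \sum_(g in (faces k :&: GI (ne := ne))%SET) \sum_(v | neighbours g k v)
     interface_work g k v.
Proof.
rewrite mulmx_sumr sc_sum; apply: eq_bigr => g _.
rewrite mulmx_sumr sc_sum; apply: eq_bigr => v _.
rewrite !mulmxA mul_mx_row row_trace row_flux mul_row_block mul_row_col.
rewrite !(scM, scD, scN, sc_scalar).
by rewrite -!/(trace _ _) -!/(flux _ _) /interface_work; ring.
Qed.

Lemma sc_sB t k : sc ((u k)^T *m sB d (zero_data t) (zero_data t) u k) =
  \sum_(g in (faces k :&: GD d)%SET)
    (TD d g k * trace g k ^+ 2 - flux g k * trace g k)
  + \sum_(g in (faces k :&: GN d)%SET) trace g k * flux g k.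
Proof.
rewrite mulmxDr scD !mulmx_sumr !sc_sum; congr (_ + _); apply: eq_bigr => g _.
  rewrite /zero_data raddf0 subr0 mulmxA mulmxBr -scalemxAr row_trace row_flux.
  by rewrite scM !(scD, scN, scZ, sc_scalar) -/(trace _ _); ring.
rewrite /zero_data raddf0 subr0 mulmxA row_trace.
by rewrite scM sc_scalar -/(flux _ _).
Qed.

Lemma sc_boundary_flux k :
  Em d k = (Rx d (rface k) k)^T *m Rx d (rface k) k
         - (Rx d (lface k) k)^T *m Rx d (lface k) k ->
  sc ((u k)^T *m (Em d k *m Lam d k *m Db d k *m u k))
  = \sum_(g in faces k) trace g k * flux g k.
Proof.
move=> hE; rewrite sum_faces hE !mulmxBl mulmxBr !mulmxA !row_trace.
rewrite -!mulmxA !mul_scalar_mx !scD scN !scZ /flux /Dg -!scalemxAl !scZ.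
rewrite /nrm eqxx (negPf (lface_neq_rface k)) !mulmxA; ring.
Qed.

Lemma sc_rhs t k : Hm d k \in unitmx ->
  Em d k = (Rx d (rface k) k)^T *m Rx d (rface k) k
         - (Rx d (lface k) k)^T *m Rx d (lface k) k ->
  sc ((u k)^T *m Hm d k *m rhs d zero_data zero_data zero_data t u k)
  = - diss k + \sum_(g in faces k) trace g k * flux g k
    - \sum_(g in (faces k :&: GI (ne := ne))%SET) \sum_(v | neighbours g k v)
        interface_work g k v
    - (\sum_(g in (faces k :&: GD d)%SET)
         (TD d g k * trace g k ^+ 2 - flux g k * trace g k)
       + \sum_(g in (faces k :&: GN d)%SET) trace g k * flux g k).
Proof.
move=> uH hE; rewrite -sc_boundary_flux// -sc_sI -(sc_sB t).
have f0 : nodal d (zero_data t) k = 0 by apply/colP => i; rewrite !mxE.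
rewrite /rhs f0 addr0 /D2 -!mulmxA -!mulmxBr mulKVmx//.
by rewrite !mulmxBr mulmxDl mulmxDr mulNmx mulmxN !(scD, scN) !mulmxA.
Qed.

End EnergyRate.

(** * Summation over interfaces *)

(** Twice the sum is the sum of [F k v + F v k]. This pairs the contributions of
    the two elements that share an interface. *)
Lemma sum_pairs_le0 (R : realDomainType) (T : finType) (e : rel T)
    (F : T -> T -> R) :
  symmetric e -> (forall k v, e k v -> F k v + F v k <= 0) ->
  \sum_k \sum_(v | e k v) F k v <= 0.
Proof.
move=> es hF; rewrite -(pmulrn_lle0 _ (ltn0Sn 1)) mulr2n.
rewrite [X in _ + X](exchange_big_dep predT)//= -big_split.
apply: sumr_le0 => k _ /=.
under [X in _ + X]eq_bigl => v do rewrite es.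
by rewrite -big_split; apply: sumr_le0 => v /hF.
Qed.

(** The boundary is split into its Dirichlet and Neumann parts, which is why the
    Dirichlet interfaces must lie on it. *)
Lemma sum_faces_split (R : realType) (ne np : nat) (d : sbp_sat R ne np)
    (F : 'I_ne.+1 -> R) (k : 'I_ne) : GD d \subset GB (ne := ne) ->
  \sum_(g in faces k) F g =
    \sum_(g in (faces k :&: GI (ne := ne))%SET) F g
    + (\sum_(g in (faces k :&: GD d)%SET) F g
       + \sum_(g in (faces k :&: GN d)%SET) F g).
Proof.
move=> /fintype.subsetP hGD; rewrite (big_setID (GI (ne := ne))) /=; congr (_ + _).
rewrite (big_setID (GD d)) /=; congr (_ + _); apply: eq_bigl => g.
  rewrite finset.in_setI [RHS]finset.in_setI finset.in_setD; have := hGD g.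
  rewrite finset.in_setC.
  by case: (g \in GD d) => [/(_ isT) ->|]; rewrite ?andbF ?andbT.
rewrite !finset.in_setD [RHS]finset.in_setI finset.in_setD finset.in_setC.
by case: (g \in faces k); case: (g \in GI); case: (g \in GD d).
Qed.

(** The conditions on the coefficients give [t3k = 1 + t2k], [t3v = - t2k] and
    [t2v = - 1 - t2k]. The products of a trace and a flux then combine into
    [- 2 a (t2k pk - t2v pv)] with the jump [a = xk - xv], so that the last two
    hypotheses, in which the two products are bounded separately, apply. *)
Lemma interface_balance (R : realFieldType)
    (xk xv pk pv dk dv rk rv ak av t1k t1v t2k t2v t3k t3v t4k t4v : R) :
  [/\ t1k = t1v, t2k + 1 = - t2v, t3k - 1 = - t3v & t4k = t4v] ->
  t3k - t2k = 1 -> 0 <= t4k ->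
  2 / ak * t2k * rk * t2k + 2 / av * t2v * rv * t2v <= t1k ->
  2 * (- (xk - xv) * t2k) * pk <= dk + 2 / ak * (- (xk - xv) * t2k) ^+ 2 * rk ->
  2 * ((xk - xv) * t2v) * pv <= dv + 2 / av * ((xk - xv) * t2v) ^+ 2 * rv ->
  (xk * pk - dk - (xk * (t1k * (xk - xv) + t3k * (pk + pv))
                   + pk * (t2k * (xk - xv) + t4k * (pk + pv))))
  + (xv * pv - dv - (xv * (t1v * (xv - xk) + t3v * (pv + pk))
                   + pv * (t2v * (xv - xk) + t4v * (pv + pk)))) <= 0.
Proof.
move=> [<- e2 e3 <-] e32 t4 h1 hk hv.
have t2vE : t2v = - 1 - t2k by lra.
have t3kE : t3k = 1 + t2k by lra.
have t3vE : t3v = - t2k by lra.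
set a := xk - xv in hk hv *.
have -> : (xk * pk - dk - (xk * (t1k * a + t3k * (pk + pv))
                   + pk * (t2k * a + t4k * (pk + pv))))
  + (xv * pv - dv - (xv * (t1k * (xv - xk) + t3v * (pv + pk))
                   + pv * (t2v * (xv - xk) + t4k * (pv + pk))))
  = (2 * (- a * t2k) * pk - dk) + (2 * (a * t2v) * pv - dv)
    - t1k * a ^+ 2 - t4k * (pk + pv) ^+ 2.
  rewrite t3kE t3vE t2vE /a; ring.
have h4 : 0 <= t4k * (pk + pv) ^+ 2 by rewrite mulr_ge0// sqr_ge0.
have := ler_wpM2r (sqr_ge0 a) h1.
have -> : (2 / ak * t2k * rk * t2k + 2 / av * t2v * rv * t2v) * a ^+ 2 =
   2 / ak * (- a * t2k) ^+ 2 * rk + 2 / av * (a * t2v) ^+ 2 * rv by ring.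
lra.
Qed.

Theorem theorem3 (R : realType) (ne np p tau : nat) (d : sbp_sat R ne np)
  (hp : (1 <= p)%N) (htau : (p <= tau)%N)
  (hmesh : mesh_ok d)
  (hD : forall k : 'I_ne, first_derivative_sbp d p tau k)
  (hD2 : forall k : 'I_ne, second_derivative_sbp d k)
  (hblocks : forall k : 'I_ne, diagonal_norm_blocks d k)
  (halpha : weights_ok d)
  (ha : forall k : 'I_ne, Db_invertible d k)
  (hb : forall k : 'I_ne, nullspace_consistent d k)
  (hc : forall k : 'I_ne, dense_norm_nullspace d k)
  (hadj : adjoint_consistent d)
  (hA : A_symmetric d)
  (hI : forall (g : 'I_ne.+1) (k v : 'I_ne), neighbours g k v ->
     2 / alpha d g k * T2 d g k * RVR d g k * T2 d g k
       + 2 / alpha d g v * T2 d g v * RVR d g v * T2 d g v <= T1 d g k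
     /\ 0 <= T4 d g k)
  (hDir : forall (g : 'I_ne.+1) (k : 'I_ne), g \in GD d -> g \in faces k ->
     2 / alpha d g k * RVR d g k <= TD d g k) :
  energy_stable d.
Proof.
have [_ xi_incr _ _ [_ GD_GB _]] := hmesh.
have [alpha0 alpha1] := halpha.
have [hT hM] := hadj.
have Hunit k : Hm d k \in unitmx.
  by have [_ [_ hpos] _ _ _] := hD k; apply: posdef_unitmx.
have hE k : Em d k = (Rx d (rface k) k)^T *m Rx d (rface k) k
                   - (Rx d (lface k) k)^T *m Rx d (lface k) k.
  by have [_ _ _ _ []] := hD k.
have bound g k (w : 'cV[R]_np) (t : R) : g \in faces k ->
    2 * t * sc (Dg d g k *m w) <= alpha d g k * sc (w^T *m Mm d k *m w)
      + 2 / alpha d g k * t ^+ 2 * RVR d g k.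
  move=> gk; have [_ _ _ _ [_ hex]] := hD k.
  have xi_lt : xi d (lface k) < xi d (rface k) by apply: xi_incr.
  have tau1 : (1 < tau.+1)%N by rewrite ltnS (leq_trans hp htau).
  exact: (flux_bound tau1 xi_lt hex (hE k) (hD2 k) (Hunit k) (hblocks k) (hc k)
            (hM k) (ha k) _ _ gk (alpha0 k g gk)).
move=> T u hu t t0 tT.
have Hsym k : (Hm d k)^T = Hm d k by have [_ [hs _] _ _ _] := hD k.
have hder := is_derive_energy Hsym (hu t t0 tT).
split; first exact: ex_derive.
rewrite derive1E (@derive_val _ _ _ _ _ _ _ hder).
rewrite pmulr_rle0//; set w := u t.
pose x g k := sc (Rx d g k *m w k); pose q g k := sc (Dg d g k *m w k).
pose D k := sc ((w k)^T *m Mm d k *m w k).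
have D0 k : 0 <= D k.
  have [_ /(_ (w k)) hpos _] := hD2 k.
  by move: hpos; rewrite -hM mulmxDr mulmxDl scD -/(D k); lra.
pose I g k v := x g k * q g k - alpha d g k * D k - interface_work d w g k v.
have rateE k : sc ((w k)^T *m Hm d k *m rhs d zero_data zero_data zero_data t w k) =
    \sum_(g in (faces k :&: GI (ne := ne))%SET) \sum_(v | neighbours g k v) I g k v
    + (\sum_(g in (faces k :&: GD d)%SET)
         (2 * x g k * q g k - alpha d g k * D k - TD d g k * x g k ^+ 2)
       - \sum_(g in (faces k :&: GN d)%SET) alpha d g k * D k).
  rewrite sc_rhs// -/(D k).
  have -> : - D k = \sum_(g in faces k) - (alpha d g k * D k).
    by rewrite sumrN -mulr_suml alpha1 mul1r.
  rewrite -big_split (sum_faces_split _ _ GD_GB) /=.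
  (* An interior face has exactly one neighbour, so the share of the face may be
     moved under the sum over the neighbours. *)
  have -> : \sum_(g in (faces k :&: GI (ne := ne))%SET)
              \sum_(v | neighbours g k v) I g k v =
     \sum_(g in (faces k :&: GI (ne := ne))%SET)
        (- (alpha d g k * D k) + x g k * q g k)
     - \sum_(g in (faces k :&: GI (ne := ne))%SET) \sum_(v | neighbours g k v)
        interface_work d w g k v.
    rewrite -sumrB; apply: eq_bigr => g; rewrite finset.in_setI => /andP[gk gI].
    have [v gv] := neighbour_unique gk gI.
    by rewrite !(big_pred1 v gv) /I; ring.
  have -> : \sum_(g in (faces k :&: GD d)%SET)
         (2 * x g k * q g k - alpha d g k * D k - TD d g k * x g k ^+ 2)
    = \sum_(g in (faces k :&: GD d)%SET) (- (alpha d g k * D k) + x g k * q g k)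
     - \sum_(g in (faces k :&: GD d)%SET) (TD d g k * x g k ^+ 2 - q g k * x g k).
    by rewrite -sumrB; apply: eq_bigr => g _; ring.
  rewrite [X in _ + (_ + X) - _ - _]big_split sumrN /= -/(x _ _).
  rewrite /x /q; ring.
under eq_bigr => k _ do rewrite rateE.
rewrite big_split /= -[leRHS]addr0; apply: lerD; last first.
  apply: sumr_le0 => k _; rewrite -[leRHS]addr0; apply: lerD.
    apply: sumr_le0 => g; rewrite finset.in_setI => /andP[gk gD].
    have h1 := bound g k (w k) (x g k) gk.
    have := ler_wpM2r (sqr_ge0 (x g k)) (hDir g k gD gk).
    move: h1; rewrite -/(q g k) -/(D k) [2 / _ * _ * RVR _ _ _]mulrAC; lra.
  rewrite oppr_le0; apply: sumr_ge0 => g; rewrite finset.in_setI => /andP[gk _].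
  by rewrite mulr_ge0// ltW// alpha0.
(* Summing over the interfaces first brings the two sides of each of them
   together. *)
have -> : \sum_k \sum_(g in (faces k :&: GI (ne := ne))%SET)
             \sum_(v | neighbours g k v) I g k v
   = \sum_(g in GI (ne := ne)) \sum_k \sum_(v | neighbours g k v) I g k v.
  rewrite exchange_big; apply: eq_bigr => k _ /=.
  rewrite [RHS](big_setID (faces k)) /= [X in _ = _ + X]big1 ?addr0.
    by rewrite finset.setIC.
  move=> g; rewrite finset.in_setD => /andP[gk _].
  by rewrite big_pred0// => v; rewrite /neighbours (negPf gk) andbF.
apply: sumr_le0 => g _; apply: sum_pairs_le0 => [k v|k v gkv].
  exact: neighbours_sym.
have /and3P[_ gk gv] := gkv.
have [h1 h4] := hI g k v gkv.
have [_ h32] := hA g k v gkv.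
exact: (interface_balance (hT g k v gkv) h32 h4 h1 (bound _ _ _ _ gk)
          (bound _ _ _ _ gv)).
Qed.
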